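(* Assume the Continuum Hypothesis. Then there exists a set $E\subseteq I^{\mathbb N}$ of cardinality $\mathfrak c$ such that (1) there is a continuous function $f:E\to I^{\mathbb N}$ which is not uniformly continuous on any subset of $E$ of cardinality $\mathfrak c$; (2) each continuous function $g:E\to\mathbb R$ is constant on a subset of $E$ of cardinality $\mathfrak c$.
   Context: $\mathfrak c=2^{\aleph_0}$, $I=[0,1]$, and $I^{\mathbb N}$ is the Hilbert cube, with the metric assigning to points $(s_0,s_1,\ldots)$, $(t_0,t_1,\ldots)$ the distance $\sum_i 2^{-i}|s_i-t_i|$ (since $I^{\mathbb N}$ is compact, any compatible metric yields the same notion of uniform continuity); subsets carry the inherited metric. A function is (not) uniformly continuous on a set $A$ if its restriction to $A$ is (not) uniformly continuous. *)

(* Defs.v *)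
From HB Require Import structures.
From mathcomp Require Import all_boot all_order all_algebra.
From mathcomp Require Import all_classical all_reals all_analysis lra.
Import Order.TTheory GRing.Theory Num.Theory.
Import numFieldNormedType.Exports.

Set Implicit Arguments.
Unset Strict Implicit.
Unset Printing Implicit Defensive.

Local Open Scope classical_set_scope.
Local Open Scope ring_scope.

(* The cardinal of the continuum is 2 ^ aleph_0, the size of the power set of
   nat. *)
Definition has_card_continuum (T : Type) (A : set T) : Prop :=
  (A #= [set: set nat])%card.

Definition continuum_hypothesis : Prop :=
  forall A : set (set nat), countable A \/ has_card_continuum A.

Definition hilbert_cube (R : realType) : Type := nat -> {i01 R}.

Section hilbert_cube_metric.
Context {R : realType}.
Implicit Types s t u : hilbert_cube R.

HB.instance Definition _ := Choice.copy (hilbert_cube R) (nat -> {i01 R}).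

Definition hilbert_dist s t : R :=
  limn (series (fun i => 2 ^- i * `|(s i)%:num - (t i)%:num|)).

Let dterm s t := fun i => 2 ^- i * `|(s i)%:num - (t i)%:num| : R.

Let dterm_ge0 s t i : 0 <= dterm s t i.
Proof. by rewrite mulr_ge0 ?invr_ge0 ?exprn_ge0. Qed.

Let hilbert_distE s t : hilbert_dist s t = limn (series (dterm s t)).
Proof. by []. Qed.

Let cvg_dterm s t : cvgn (series (dterm s t)).
Proof.
apply: (@series_le_cvg _ _ (geometric 1 2^-1)) => [i|i|i|].
- exact: dterm_ge0.
- by rewrite /geometric/= mul1r exprn_ge0// invr_ge0.
- rewrite /dterm /geometric/= mul1r exprVn ler_piMr ?invr_ge0 ?exprn_ge0//.
  have s_ge0 : 0 <= (s i)%:num by []; have s_le1 : (s i)%:num <= 1 by [].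
  have t_ge0 : 0 <= (t i)%:num by []; have t_le1 : (t i)%:num <= 1 by [].
  by rewrite ler_norml; lra.
- apply: is_cvg_geometric_series.
  by rewrite ger0_norm ?invr_ge0// invf_lt1// ltr1n.
Qed.

Let hilbert_distxx s : hilbert_dist s s = 0.
Proof.
rewrite hilbert_distE (_ : series _ = cst 0) ?lim_cst//.
apply/funext => n; rewrite /series/= big1// => i _.
by rewrite /dterm subrr normr0 mulr0.
Qed.

Let hilbert_dist_eq0 s t : hilbert_dist s t = 0 -> s = t.
Proof.
rewrite hilbert_distE => st0; apply/funext => n; apply/val_inj => /=.
have : dterm s t n <= 0.
  rewrite -st0; apply: (@le_trans _ _ (series (dterm s t) n.+1)).
    by rewrite /series/= big_nat_recr//= lerDr sumr_ge0.
  apply: nondecreasing_cvgn_le; last exact: cvg_dterm.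
  by apply/nondecreasing_seqP => k; rewrite /series/= big_nat_recr//= lerDl.
rewrite /dterm pmulr_rle0 ?invr_gt0 ?exprn_gt0// normr_le0 subr_eq0.
by move/eqP.
Qed.

Let hilbert_dist_sym s t : hilbert_dist s t = hilbert_dist t s.
Proof.
rewrite !hilbert_distE; congr (limn (series _)).
by apply/funext => i; rewrite /dterm distrC.
Qed.

Let hilbert_dist_triangle t s u :
  hilbert_dist s u <= hilbert_dist s t + hilbert_dist t u.
Proof.
rewrite !hilbert_distE -(lim_seriesD (@cvg_dterm s t) (@cvg_dterm t u)).
apply: lim_series_le => [||n]; first exact: cvg_dterm.
  exact/is_cvg_seriesD.
rewrite /dterm !fctE -mulrDr ler_wpM2l ?invr_ge0 ?exprn_ge0//.
exact: ler_distD.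
Qed.

HB.instance Definition _ := @isMetric.Build R (hilbert_cube R) hilbert_dist
  hilbert_distxx hilbert_dist_eq0 hilbert_dist_sym hilbert_dist_triangle.

End hilbert_cube_metric.

Definition unif_continuous_on (T U : uniformType) (A : set T) (f : T -> U)
  : Prop := unif_continuous (f : subspace A -> U).

(* Main.v *)
Require Import Defs.
From mathcomp Require Import all_boot all_order all_algebra.
From mathcomp Require Import all_classical all_reals all_analysis lra.
From mathcomp Require wochoice.
Import Order.TTheory GRing.Theory Num.Theory.
Import numFieldNormedType.Exports.
Local Open Scope classical_set_scope.
Local Open Scope ring_scope.

(** Let X be the set of points of the Hilbert cube with no vanishing coordinate,
    and let f : X -> I^N apply the function t |-> sin(1/t)^2 to each coordinate
    ([osc_map]). Call a subset of X small if it is covered by countably many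
    relatively closed sets on which f is uniformly continuous (a weaker
    condition, [tame], is used in place of uniform continuity).

    The heart of the proof is [separator_not_tame]: if U and V are disjoint open
    subsets of X that meet a cylinder O, then f is not uniformly continuous on
    the part L of O outside U and V. Indeed, choose u in U and v in V, both in
    O; for m large, membership of u in U and of v in V depends on the first m
    coordinates only. Join u to v by a segment in these m coordinates, with time
    r, and let the next two coordinates s, t vary near 0. If f is uniformly
    continuous on L, then, for r in a short interval and s, t small, all the
    points of L have about the same values (g1, g2) of the coordinates m and m+1
    of f. Hence L contains no point (r, s, t) such that the value at s is far
    from g1 or the value at t is far from g2. These points form a grid-like
    connected set, which therefore lies in U or in V. Two overlapping intervals
    of times are of the same type: their grids intersect, since s can be chosen
    far from the first g1 and t far from the second g2. So all the times from 0
    to 1 are of the type of u, which contradicts the choice of v.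

    A Baire category argument ([separator_baire]) then shows that L is not
    small. It follows ([large_fibre]) that, for a real function g which is
    continuous outside a small set, some fibre of g is not small: otherwise,
    either the sets g < c and c < g, for a suitable value c, would be separated
    by a small set only, or g would be constant outside a small set, and X itself
    would be small.

    Finally, a real function continuous on a subset of X is determined, at each
    point of this subset, by its values on a dense sequence; so there are only
    continuum many functions and continuum many small sets to consider. Under
    the continuum hypothesis a transfinite construction of length omega_1
    ([luzin_set]) gives a set E that meets each small set in a countable set,
    and each relevant non-small set in uncountably many points. The map f is not
    uniformly continuous on an uncountable subset A of E, since A would be
    small. Given a continuous g : E -> R, the set where the limit of g along a
    dense sequence of E does not exist is disjoint from E, hence small; so g has
    a non-small fibre, which contains uncountably many points of E. *)

(** * Cylinder neighbourhoods in the Hilbert cube *)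

Section cylinders.
Context {R : realType}.
Local Notation H := (hilbert_cube R).
Implicit Types (x y z : H) (U V F : set H).

(** The radius [2^-n], used both as the radius of the [n]-th cylinder and as
    the weight of the [n]-th coordinate in the metric. *)
Definition dyad n : R := 2 ^- n.

Lemma dyad_gt0 n : 0 < dyad n.
Proof. by rewrite invr_gt0 exprn_gt0. Qed.

Lemma dyad_double n : dyad n = dyad n.+1 + dyad n.+1.
Proof.
rewrite /dyad exprS invfM.
by rewrite -[LHS]mul1r {1}(splitr 1) mulrDl mul1r.
Qed.

Lemma dyad0 : dyad 0 = 1.
Proof. by rewrite /dyad expr0 invr1. Qed.

Lemma dyad_le m n : (m <= n)%N -> dyad n <= dyad m.
Proof.
move=> /subnK <-; elim: (n - m)%N => [|k ih]; first by rewrite add0n.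
apply: le_trans ih; rewrite addSn (dyad_double (k + m)).
by rewrite lerDl ltW// dyad_gt0.
Qed.

Lemma dyad_le1 n : dyad n <= 1.
Proof. by rewrite -dyad0 dyad_le. Qed.

Lemma dyad_lt_ex (e : R) : 0 < e -> exists n, dyad n < e.
Proof.
move=> e0; have [n en] : exists n : nat, e^-1 < n%:R.
  by exists (Num.truncn e^-1).+1; exact: truncnS_gt.
exists n; rewrite /dyad invf_plt ?posrE ?exprn_gt0//.
apply: (lt_trans en); rewrite -natrX ltr_nat; exact: ltn_expl.
Qed.

(** [cyl n x] is the cylinder of radius [2^-n] around [x] in the first [n]
    coordinates; these relations form a countable base of the uniformity. *)
Definition cyl n x y := forall i, (i < n)%N -> `|(x i)%:num - (y i)%:num| < dyad n.

Lemma cyl_refl n x : cyl n x x.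
Proof. by move=> i _; rewrite subrr normr0 dyad_gt0. Qed.

Lemma cyl_sym n x y : cyl n x y -> cyl n y x.
Proof. by move=> xy i /xy; rewrite distrC. Qed.

Lemma cyl_le m n x y : (m <= n)%N -> cyl n x y -> cyl m x y.
Proof.
move=> mn xy i im; apply: lt_le_trans (dyad_le _ _ mn).
by apply: xy; exact: leq_trans mn.
Qed.

Lemma cyl_trans n x y z : cyl n.+1 x y -> cyl n.+1 y z -> cyl n x z.
Proof.
move=> xy yz i ni; rewrite -(subrKA (y i)%:num) dyad_double.
by rewrite (le_lt_trans (ler_normD _ _))// ltrD// ?xy ?yz// ltnS ltnW.
Qed.

Lemma cyl_interior n x y : cyl n x y ->
  exists m, forall z, cyl m y z -> cyl n x z.
Proof.
move=> xy.
suff [m hm] : exists m, forall z, cyl m y z ->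
    forall i, (i < n)%N -> `|(x i)%:num - (z i)%:num| < dyad n by exists m.
suff [m hm] : exists m, (n <= m)%N /\
    forall i, (i < n)%N -> `|(x i)%:num - (y i)%:num| + dyad m < dyad n.
  exists m => z yz i ni; apply: le_lt_trans (hm.2 _ ni).
  rewrite -(subrKA (y i)%:num) (le_trans (ler_normD _ _))// lerD2l ltW// yz//.
  exact: leq_trans ni hm.1.
have : forall k, (k <= n)%N -> exists m, (n <= m)%N /\
    forall i, (i < k)%N -> `|(x i)%:num - (y i)%:num| + dyad m < dyad n.
  elim=> [|k ih] kn; first by exists n.
  have [m [nm hm]] := ih (ltnW kn).
  have /dyad_lt_ex[m' hm'] : 0 < dyad n - `|(x k)%:num - (y k)%:num|.
    by rewrite subr_gt0 xy.
  exists (maxn m m'); split=> [|i]; first by rewrite leq_max nm.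
  rewrite ltnS leq_eqVlt => /predU1P[->|/hm]; last first.
    by apply: le_lt_trans; rewrite lerD2l dyad_le// leq_maxl.
  rewrite addrC -ltrBrDr; apply: le_lt_trans hm'.
  by rewrite dyad_le// leq_maxr.
by move=> /(_ _ (leqnn n)).
Qed.

Let dterm x y i : R := 2 ^- i * `|(x i)%:num - (y i)%:num|.

Let dterm_ge0 x y i : 0 <= dterm x y i.
Proof. by rewrite mulr_ge0 ?invr_ge0 ?exprn_ge0. Qed.

Lemma coord_dist_le1 x y i : `|(x i)%:num - (y i)%:num| <= 1.
Proof.
have x_ge0 : 0 <= (x i)%:num by []; have x_le1 : (x i)%:num <= 1 by [].
have y_ge0 : 0 <= (y i)%:num by []; have y_le1 : (y i)%:num <= 1 by [].
by rewrite ler_norml; lra.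
Qed.

Let ndseries x y : {homo series (dterm x y) : m n / (m <= n)%N >-> m <= n}.
Proof.
apply/nondecreasing_seqP => k; rewrite /series/= big_nat_recr//= lerDl.
exact: dterm_ge0.
Qed.

Let series_le x y n N : cyl n x y ->
  series (dterm x y) N <= 4 * dyad n.
Proof.
move=> xy.
have h1 m : (m <= n)%N -> series (dterm x y) m <= (2 - 2 * dyad m) * dyad n.
  elim: m => [_|m ih mn].
    by rewrite /series/= big_geq// dyad0 mulr1 subrr mul0r.
  rewrite /series/= big_nat_recr//=.
  have := ih (ltnW mn); rewrite /series/= => {}ih.
  apply: (le_trans (lerD ih (_ : _ <= dyad m * dyad n))).
    by rewrite ler_wpM2l ?(ltW (dyad_gt0 _))// ltW// xy.
  by rewrite -mulrDl ler_wpM2r ?(ltW (dyad_gt0 _))// (dyad_double m); lra.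
have h2 m : (n <= m)%N -> series (dterm x y) m <= 4 * dyad n - 2 * dyad m.
  move=> /subnK <-; elim: (m - n)%N => [|k ih].
    rewrite add0n; apply: (le_trans (h1 _ (leqnn n))).
    have := dyad_gt0 n; nra.
  rewrite addSn /series/= big_nat_recr//=.
  move: ih; rewrite /series/= => ih.
  apply: (le_trans (lerD ih (_ : _ <= dyad (k + n)))).
    by rewrite ler_piMr ?coord_dist_le1// ltW// dyad_gt0.
  by rewrite (dyad_double (k + n)); lra.
have [nN|/ltnW Nn] := leqP n N.
  by have := h2 _ nN; have := dyad_gt0 N; lra.
have := h1 _ Nn; have := dyad_gt0 N; have := dyad_gt0 n; nra.
Qed.

Let cvg_dterm x y : cvgn (series (dterm x y)).
Proof.
apply: nondecreasing_is_cvgn; first exact: ndseries.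
exists (4 * dyad 0) => _ [N _ <-]; exact: series_le.
Qed.

(** The next two lemmas show that the metric and the cylinders define the same
    uniformity. *)
Lemma dist_cyl n x y : cyl n x y -> hilbert_dist x y <= 4 * dyad n.
Proof.
move=> xy; rewrite /hilbert_dist -/(dterm x y).
apply: limr_le; first exact: cvg_dterm.
by apply: nearW => N; exact: series_le.
Qed.

Lemma cyl_dist n x y : hilbert_dist x y < dyad (n + n) -> cyl n x y.
Proof.
move=> xy i ni.
have : dterm x y i <= hilbert_dist x y.
  apply: (@le_trans _ _ (series (dterm x y) i.+1)).
    by rewrite /series/= big_nat_recr//= lerDr sumr_ge0.
  apply: nondecreasing_cvgn_le; [exact: ndseries|exact: cvg_dterm].
move=> /le_lt_trans/(_ xy); rewrite /dterm => h.
rewrite -(ltr_pM2l (dyad_gt0 i)); apply: (lt_le_trans h).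
rewrite {1}/dyad exprD invfM ler_wpM2r// ?(ltW (dyad_gt0 _))//.
by rewrite dyad_le// ltnW.
Qed.

Lemma ball_cyl (e : R) : 0 < e ->
  exists n, forall x y, cyl n x y -> ball x e y.
Proof.
move=> e0; have /dyad_lt_ex[n hn] : 0 < e / 4 by rewrite divr_gt0.
exists n => x y /dist_cyl xy; rewrite ballEmdist/=.
apply: le_lt_trans (xy : mdist x y <= _) _.
by rewrite mulrC -ltr_pdivlMr.
Qed.

Lemma cyl_ball n x y : ball x (dyad (n + n)) y -> cyl n x y.
Proof. by rewrite ballEmdist/= => xy; apply: cyl_dist. Qed.

Lemma nbhs_cyl n x : nbhs x (cyl n x).
Proof.
by apply/nbhs_ballP; exists (dyad (n + n)); [exact: dyad_gt0|move=> y /cyl_ball].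
Qed.

Lemma cyl_nbhs x (A : set H) : nbhs x A ->
  exists n, forall y, cyl n x y -> A y.
Proof.
move=> /nbhs_ballP[e e0 eA]; have [n hn] := ball_cyl e e0.
by exists n => y xy; apply: eA; exact: hn.
Qed.

End cylinders.
Arguments dyad {R} n.

(** * Segments in the positive part of the cube *)

Section segments.
Context {R : realType}.
Local Notation H := (hilbert_cube R).
Implicit Types (x y z : H) (U V F : set H).

(** The underlying space: points of the cube with no vanishing coordinate. *)
Definition positive : set H := [set x | forall i, 0 < (x i)%:num].

(** Relative openness in [positive], for a set whose points outside [positive]
    do not matter. *)
Definition open_pos U :=
  forall x, positive x -> U x ->
  exists n, forall y, positive y -> cyl n x y -> U y.

Definition closed_pos F := open_pos (~` F).

Definition disjoint_pos U V := forall x, positive x -> U x -> V x -> False.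

Fact clamp_ge0 (t : R) : 0 <= Num.max 0 (Num.min t 1).
Proof. by rewrite le_max lexx. Qed.

Fact clamp_le1 (t : R) : Num.max 0 (Num.min t 1) <= 1.
Proof. by rewrite ge_max ler01 ge_min lexx orbT. Qed.

(** The nearest point of the unit interval. *)
Definition clamp (t : R) : {i01 R} := Itv01 (clamp_ge0 t) (clamp_le1 t).

Lemma clampE (t : R) : 0 <= t <= 1 -> (clamp t)%:num = t.
Proof.
by move=> /andP[t0 t1]; rewrite [LHS]/= min_l// max_r.
Qed.

Definition segment x y (t : R) : H :=
  fun i => clamp ((1 - t) * (x i)%:num + t * (y i)%:num).

Lemma segmentE x y t i : 0 <= t <= 1 ->
  (segment x y t i)%:num = (1 - t) * (x i)%:num + t * (y i)%:num.
Proof.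
move=> /andP[t0 t1]; rewrite clampE//.
have x_ge0 : 0 <= (x i)%:num by []; have x_le1 : (x i)%:num <= 1 by [].
have y_ge0 : 0 <= (y i)%:num by []; have y_le1 : (y i)%:num <= 1 by [].
by apply/andP; split; nra.
Qed.

Lemma segment0 x y : segment x y 0 = x.
Proof.
apply/funext => i; apply/val_inj; change ((segment x y 0 i)%:num = (x i)%:num).
by rewrite segmentE ?lexx ?ler01//; lra.
Qed.

Lemma segment1 x y : segment x y 1 = y.
Proof.
apply/funext => i; apply/val_inj; change ((segment x y 1 i)%:num = (y i)%:num).
by rewrite segmentE ?lexx ?ler01//; lra.
Qed.

Lemma segment_positive x y t : 0 <= t <= 1 ->
  positive x -> positive y -> positive (segment x y t).
Proof.
move=> t01 px py i; rewrite segmentE//; case/andP: t01 => t0 t1.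
have := px i; have := py i; nra.
Qed.

Lemma segment_cyl n c x y t : 0 <= t <= 1 ->
  cyl n c x -> cyl n c y -> cyl n c (segment x y t).
Proof.
move=> t01 cx cy i ni; rewrite segmentE//; case/andP: t01 => t0 t1.
have r_gt : Num.max `|(c i)%:num - (x i)%:num| `|(c i)%:num - (y i)%:num| < dyad n.
  by rewrite gt_max cx ?cy.
apply: le_lt_trans r_gt; set M := Num.max _ _.
have xM : `|(c i)%:num - (x i)%:num| <= M by rewrite le_max lexx.
have yM : `|(c i)%:num - (y i)%:num| <= M by rewrite le_max lexx orbT.
move: xM yM; rewrite !ler_norml => /andP[x1 x2] /andP[y1 y2].
by apply/andP; split; nra.
Qed.

Lemma segment_lipschitz n x y s t : 0 <= s <= 1 -> 0 <= t <= 1 ->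
  `|s - t| < dyad n -> cyl n (segment x y s) (segment x y t).
Proof.
move=> s01 t01 st i _; rewrite !segmentE//.
rewrite (_ : _ - _ = (s - t) * ((y i)%:num - (x i)%:num)); last by lra.
by rewrite normrM (le_lt_trans _ st)// ler_piMr// coord_dist_le1.
Qed.

(** Connectedness of a segment. *)
Lemma segment_leaves U V x y : open_pos U -> open_pos V -> disjoint_pos U V ->
  positive x -> positive y -> U x -> V y ->
  exists t, [/\ 0 <= t <= 1, ~ U (segment x y t) & ~ V (segment x y t)].
Proof.
move=> oU oV dUV px py Ux Vy.
pose T := [set t : R | 0 <= t <= 1 /\ U (segment x y t)].
have T0 : T 0 by split; rewrite ?lexx ?ler01// segment0.
have hT : has_sup T by split; [exists 0|exists 1 => t [/andP[]]].
have s01 : 0 <= sup T <= 1.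
  by rewrite ub_le_sup//= ?ge_sup//; [exists 0|move=> t [/andP[]]|exact: hT.2].
have ps := segment_positive _ _ _ s01 px py.
exists (sup T); split => // [Us|Vs].
  have [n hn] := oU _ ps Us.
  have s1 : sup T < 1.
    rewrite lt_neqAle; case/andP: s01 => _ ->; rewrite andbT.
    apply/eqP => s1; move: Us; rewrite s1 segment1 => Uy; exact: dUV Vy.
  pose t := Num.min 1 (sup T + dyad n / 2).
  have st : sup T < t by rewrite lt_min s1/= ltrDl divr_gt0// dyad_gt0.
  have t01 : 0 <= t <= 1.
    rewrite ge_min lexx/= andbT (le_trans _ (ltW st))//.
    by case/andP: s01.
  have : T t.
    split=> //; apply: hn; first exact: segment_positive.
    apply: segment_lipschitz => //.
    rewrite ltr0_norm ?subr_lt0// opprB ltrBlDl.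
    rewrite gt_min; apply/orP; right.
    by rewrite ltrD2l; have := @dyad_gt0 R n; lra.
  by move=> /(ub_le_sup hT.2); rewrite leNgt st.
have [n hn] := oV _ ps Vs.
have [t [t01 Ut] st] := sup_adherent (@dyad_gt0 R n) hT.
have ts : t <= sup T by apply: (ub_le_sup hT.2); split.
apply: (dUV (segment x y t)) => //; first exact: segment_positive.
apply: hn; first exact: segment_positive.
apply: segment_lipschitz => //.
by rewrite ger0_norm ?subr_ge0// ltrBlDr -ltrBlDl.
Qed.

(** If a segment from a point of [U] avoids the complement of [U] and [V],
    then it ends in [U]. *)
Lemma segment_stays U V x y : open_pos U -> open_pos V -> disjoint_pos U V ->
  positive x -> positive y -> U x ->
  (forall t, 0 <= t <= 1 -> U (segment x y t) \/ V (segment x y t)) -> U y.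
Proof.
move=> oU oV dUV px py Ux UV.
have [||Vy] := UV 1; first by rewrite lexx ler01.
  by rewrite segment1.
have [|t [t01 nU nV]] := @segment_leaves U V x y oU oV dUV px py Ux.
  by rewrite -(segment1 x y).
by have [] := UV t t01.
Qed.

End segments.
Arguments positive {R}.

(** * The oscillating map *)

Section oscillation.
Context {R : realType}.
Local Notation H := (hilbert_cube R).
Implicit Types (x y z : H) (U V F : set H).

(** A continuous function on the half-open unit interval, with values in the
    unit interval, that oscillates between 0 and 1 near 0. *)
Definition osc (t : R) : R := sin t^-1 ^+ 2.

Lemma osc_ge0 (t : R) : 0 <= osc t.
Proof. exact: sqr_ge0. Qed.

Lemma osc_le1 (t : R) : osc t <= 1.
Proof. by rewrite /osc sin2cos2 gerBl sqr_ge0. Qed.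

Lemma osc_continuous (t : R) : 0 < t -> {for t, continuous osc}.
Proof.
move=> t0.
apply: (@continuous_comp _ _ _ (fun s : R => sin s^-1) (fun s => s ^+ 2)).
  apply: (@continuous_comp _ _ _ (fun s : R => s^-1) sin).
    by apply: inv_continuous; rewrite gt_eqF.
  exact: continuous_sin.
exact: exprn_continuous.
Qed.

Lemma osc_far (d g : R) : 0 < d ->
  exists t, [/\ 0 < t < d, t <= 1 & 1 / 3 < `|osc t - g|].
Proof.
move=> d0; have pi0 : 0 < pi :> R := pi_gt0 R.
pose k := (Num.truncn d^-1).+1.
have kd : d^-1 < k%:R by exact: truncnS_gt.
have pik : d^-1 < pi *+ k /\ 1 <= pi *+ k :> R.
  have pi1 : 1 < pi :> R by have := @pi_ge2 R; lra.
  have k1 : 1 <= k%:R :> R by rewrite ler1n.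
  rewrite -mulr_natr; split; last by nra.
  by apply: (lt_le_trans kd); nra.
have key (s : R) : pi *+ k <= s -> 0 < s^-1 < d /\ s^-1 <= 1.
  move=> ks; have s1 : 1 <= s by apply: le_trans ks; exact: pik.2.
  have s0 : 0 < s by lra.
  split; last by rewrite invf_le1.
  rewrite invr_gt0 s0/= invf_plt ?posrE//.
  by apply: lt_le_trans ks; exact: pik.1.
have [|] := leP g (1 / 2) => hg.
  have [|h1 h2] := key (pi / 2 + pi *+ k); first by rewrite lerDr divr_ge0// ltW.
  exists (pi / 2 + pi *+ k)^-1; split=> //.
  rewrite /osc invrK alternatingn; last exact: sinDpi.
  rewrite sin_pihalf mulr1 sqrr_sign.
  by rewrite ger0_norm; lra.
have [|h1 h2] := key (0 + pi *+ k); first by rewrite add0r.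
exists (0 + pi *+ k)^-1; split=> //.
rewrite /osc invrK alternatingn; last exact: sinDpi.
rewrite sin0 mulr0 expr0n/= sub0r normrN.
by rewrite ger0_norm; lra.
Qed.

Definition osc_map x : H :=
  fun i => Itv01 (osc_ge0 (x i)%:num) (osc_le1 (x i)%:num).

Lemma osc_cyl x i (e : R) : positive x -> 0 < e ->
  exists n, forall y, cyl n x y ->
    `|osc (x i)%:num - osc (y i)%:num| < e.
Proof.
move=> px e0; have := osc_continuous _ (px i).
move=> /cvgrPdist_lt/(_ _ e0)/nbhs_ballP[d /= d0 hd].
have [n hn] := dyad_lt_ex d d0.
exists (maxn n i.+1) => y xy; apply: hd; rewrite /ball/=.
apply: lt_trans hn; apply: lt_le_trans (xy i _) _; first by rewrite leq_maxr.
by rewrite dyad_le// leq_maxl.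
Qed.

Lemma osc_map_continuous x : positive x -> {for x, continuous osc_map}.
Proof.
move=> px A /=; rewrite -[nbhs (osc_map x) A]/(nbhs (osc_map x) A).
move=> /cyl_nbhs[n hn].
suff : exists m, forall y, cyl m x y -> cyl n (osc_map x) (osc_map y).
  move=> [m hm]; apply: filterS (nbhs_cyl m x) => y xy /=.
  by apply: hn; exact: hm.
have : forall k, exists m, forall y, cyl m x y -> forall i, (i < k)%N ->
    `|osc (x i)%:num - osc (y i)%:num| < dyad n.
  elim=> [|k [m hm]]; first by exists 0%N.
  have [m' hm'] := osc_cyl _ k _ px (@dyad_gt0 R n).
  exists (maxn m m') => y xy i; rewrite ltnS leq_eqVlt => /predU1P[->|].
    by apply: hm'; apply: cyl_le xy; rewrite leq_maxr.
  by apply: hm; apply: cyl_le xy; rewrite leq_maxl.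
by move=> /(_ n)[m hm]; exists m => y /hm.
Qed.

(** The only consequence of the uniform continuity of [osc_map] on [F] that is
    needed: each coordinate of [osc_map] differs by at most 1/3 at any two
    points of [F] that are close, at a scale depending on this coordinate only. *)
Definition tame F := forall i, exists m, forall x y, F x -> F y ->
  cyl m x y -> `|osc (x i)%:num - osc (y i)%:num| <= 1 / 3.

Lemma unif_continuous_tame (A : set H) :
  unif_continuous_on A osc_map -> tame A.
Proof.
move=> uA i.
have : entourage [set xy : H * H | ball xy.1 (dyad (i.+2 + i.+2)) xy.2].
  rewrite -entourage_ballE; exists (dyad (i.+2 + i.+2)) => //=.
  exact: dyad_gt0.
move=> /uA [E entE hE].
move: entE; rewrite -entourage_ballE => -[e /= e0 eE].
have [m hm] := ball_cyl e e0.
exists m => x y Ax Ay xy.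
have : cyl i.+2 (osc_map x) (osc_map y).
  apply: cyl_ball; apply: (hE (x, y)); right; split=> //; split=> //.
  by apply: eE; exact: hm.
move=> /(_ i (leqnSn _))/ltW/le_trans; apply.
apply: (le_trans (dyad_le 2 i.+2 isT)).
by rewrite /dyad; lra.
Qed.

End oscillation.

(** * Boundaries are not tame *)

Section core.
Context {R : realType}.
Local Notation H := (hilbert_cube R).
Implicit Types (x y z : H) (U V F : set H).

(** The pairs at which one of the two coordinates of [osc] is far from the
    prescribed value [g]. Any two such pairs are joined by a polygonal line of
    such pairs. *)
Definition far_pair (g : R * R) (s t : R) :=
  1 / 3 < `|osc s - g.1| \/ 1 / 3 < `|osc t - g.2|.

Section grid.
Variables (U V F : set H) (N : nat) (c u v : H) (m p : nat).
Hypotheses (oU : open_pos U) (oV : open_pos V) (dUV : disjoint_pos U V).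
Hypotheses (pu : positive u) (pv : positive v).
Hypotheses (cu : cyl N c u) (cv : cyl N c v) (Nm : (N <= m)%N).
Hypothesis Uu : forall y, positive y -> cyl m u y -> U y.
Hypothesis Vv : forall y, positive y -> cyl m v y -> V y.
Hypothesis sub : forall x, positive x -> cyl N c x -> ~ U x -> ~ V x -> F x.
Hypothesis tame0 : forall x y, F x -> F y -> cyl p x y ->
  `|osc (x m)%:num - osc (y m)%:num| <= 1 / 3.
Hypothesis tame1 : forall x y, F x -> F y -> cyl p x y ->
  `|osc (x m.+1)%:num - osc (y m.+1)%:num| <= 1 / 3.

(** The point at time [r] of the segment from [u] to [v] in the first [m]
    coordinates, followed by the coordinates [s] and [t], then by ones. *)
Let pt (r s t : R) : H := fun i => if (i < m)%N then segment u v r i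
  else if i == m then clamp s else if i == m.+1 then clamp t else clamp 1.

Let unit_itv (r : R) := 0 <= r <= 1.
Let good (t : R) := 0 < t < dyad p /\ t <= 1.

Let good01 t : good t -> 0 <= t <= 1.
Proof. by move=> [/andP[/ltW-> _] ->]. Qed.

Let pt_lo r s t i : unit_itv r -> (i < m)%N ->
  (pt r s t i)%:num = (1 - r) * (u i)%:num + r * (v i)%:num.
Proof. by move=> r01 im; rewrite /pt im segmentE. Qed.

Let pt_m r s t : good s -> (pt r s t m)%:num = s.
Proof. by move=> gs; rewrite /pt ltnn eqxx clampE// good01. Qed.

Let pt_m1 r s t : good t -> (pt r s t m.+1)%:num = t.
Proof.
move=> gt; rewrite /pt ltnNge leqnSn/= gtn_eqF ?ltnSn// eqxx.
by rewrite clampE// good01.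
Qed.

Let pt_hi r s t i : (m.+1 < i)%N -> (pt r s t i)%:num = 1.
Proof.
move=> mi; rewrite /pt ltnNge (ltnW (ltnW mi))/= !gtn_eqF// ?(ltnW mi)//.
by rewrite clampE// ler01 lexx.
Qed.

Let coordP i : [\/ (i < m)%N, i = m, i = m.+1 | (m.+1 < i)%N].
Proof.
have [im|mi|->] := ltngtP i m; [by constructor 1| |by constructor 2].
have [mi'|mi'|->] := ltngtP m.+1 i; [by constructor 4| |by constructor 3].
by move: mi'; rewrite ltnS leqNgt mi.
Qed.

Let pt_positive r s t : unit_itv r -> good s -> good t -> positive (pt r s t).
Proof.
move=> r01 gs gt i; case: (coordP i) => [im|->|->|mi].
- by rewrite /pt im; exact: segment_positive.
- by rewrite pt_m//; case: gs => /andP[].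
- by rewrite pt_m1//; case: gt => /andP[].
- by rewrite pt_hi.
Qed.

Let pt_cyl r s t : unit_itv r -> cyl N c (pt r s t).
Proof.
move=> r01 i iN; rewrite /pt (leq_trans iN Nm).
exact: segment_cyl.
Qed.

Let pt_close r s t r' s' t' : unit_itv r -> unit_itv r' ->
  good s -> good t -> good s' -> good t' ->
  `|r - r'| < dyad p -> cyl p (pt r s t) (pt r' s' t').
Proof.
move=> r01 r'01 gs gt gs' gt' rr' i _.
have gg a b : good a -> good b -> `|a - b| < dyad p.
  by move=> [/andP[? ?] _] [/andP[? ?] _]; rewrite ltr_norml; lra.
case: (coordP i) => [im|->|->|mi].
- rewrite !pt_lo//.
  rewrite (_ : _ - _ = (r - r') * ((v i)%:num - (u i)%:num)); last by lra.
  by rewrite normrM (le_lt_trans _ rr')// ler_piMr// coord_dist_le1.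
- by rewrite !pt_m//; exact: gg.
- by rewrite !pt_m1//; exact: gg.
- by rewrite !pt_hi// subrr normr0 dyad_gt0.
Qed.

Let convex_unit (r r' a : R) : 0 <= a <= 1 -> unit_itv r -> unit_itv r' ->
  unit_itv ((1 - a) * r + a * r').
Proof.
move=> /andP[? ?] /andP[? ?] /andP[? ?]; apply/andP; split; nra.
Qed.

Let convex_good (r r' a : R) : 0 <= a <= 1 -> good r -> good r' ->
  good ((1 - a) * r + a * r').
Proof.
move=> /andP[a0 a1] [/andP[r0 rd] r1] [/andP[r'0 r'd] r'1].
split; last by nra.
apply/andP; split.
  have : 0 < Num.min r r' by rewrite lt_min r0.
  have : Num.min r r' <= r by rewrite ge_min lexx.
  have : Num.min r r' <= r' by rewrite ge_min lexx orbT.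
  by nra.
have : Num.max r r' < dyad p by rewrite gt_max rd.
have : r <= Num.max r r' by rewrite le_max lexx.
have : r' <= Num.max r r' by rewrite le_max lexx orbT.
by nra.
Qed.

Let segment_pt r s t r' s' t' a : 0 <= a <= 1 -> unit_itv r -> unit_itv r' ->
  good s -> good t -> good s' -> good t' ->
  segment (pt r s t) (pt r' s' t') a =
  pt ((1 - a) * r + a * r') ((1 - a) * s + a * s') ((1 - a) * t + a * t').
Proof.
move=> a01 r01 r'01 gs gt gs' gt'; apply/funext => i; apply/val_inj.
rewrite -[LHS]/((segment (pt r s t) (pt r' s' t') a i)%:num).
rewrite -[RHS]/((pt _ _ _ i)%:num).
rewrite segmentE//; case: (coordP i) => [im|->|->|mi].
- by rewrite !pt_lo//; [lra|exact: convex_unit].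
- by rewrite !pt_m//; exact: convex_good.
- by rewrite !pt_m1//; exact: convex_good.
- by rewrite !pt_hi//; lra.
Qed.

Let outside r s t := ~ U (pt r s t) /\ ~ V (pt r s t).

Let outside_F r s t : unit_itv r -> good s -> good t -> outside r s t ->
  F (pt r s t).
Proof.
by move=> r01 gs gt [nU nV]; apply: sub => //; [exact: pt_positive|exact: pt_cyl].
Qed.

(** The time [r] has type [W] when there is a reference pair [g] such that, at
    all times close to [r], the points [pt] whose last two free coordinates are
    small and form a far pair for [g] belong to [W]. *)
Let type (W : set H) r := exists g, forall r' s t, unit_itv r' ->
  `|r' - r| < dyad p.+1 -> good s -> good t -> far_pair g s t -> W (pt r' s t).

Let two_good (g g' : R * R) : exists s t,
  [/\ good s, good t, far_pair g s t & far_pair g' s t].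
Proof.
have [s [sd s1 sg]] := osc_far _ g.1 (@dyad_gt0 R p).
have [t [td t1 tg]] := osc_far _ g'.2 (@dyad_gt0 R p).
by exists s, t; split=> //; [left|right].
Qed.

Let type_disjoint r r' : unit_itv r -> `|r - r'| < dyad p.+1 ->
  type U r -> type V r' -> False.
Proof.
move=> r01 rr' [g hg] [g' hg'].
have [s [t [gs gt sg tg]]] := two_good g g'.
apply: (dUV (pt r s t)); first exact: pt_positive.
  by apply: hg => //; rewrite subrr normr0 dyad_gt0.
exact: hg'.
Qed.

(** All the points outside [U] and [V] at times close to [r] have about the same
    values of [osc] in the coordinates [m] and [m.+1]; so the points with a far
    pair, being connected to each other, lie on one side. *)
Let type_total r : unit_itv r -> type U r \/ type V r.
Proof.
move=> r01.
have [g hg] : exists g, forall r' s t, unit_itv r' -> `|r' - r| < dyad p.+1 ->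
    good s -> good t -> far_pair g s t -> ~ outside r' s t.
  have [[[[r0 s0] t0] /= [r001 r0r gs0 gt0 o0]]|no] := pselect (exists q : R * R * R,
     let: (r', s, t) := q in [/\ unit_itv r', `|r' - r| < dyad p.+1,
      good s, good t & outside r' s t]); last first.
    exists (0, 0) => r' s t r'01 r'r gs gt _ o.
    by apply: no; exists (r', s, t).
  exists (osc s0, osc t0) => r' s t r'01 r'r gs gt fst o.
  have Fx := outside_F r' s t r'01 gs gt o.
  have Fy := outside_F r0 s0 t0 r001 gs0 gt0 o0.
  have xy : cyl p (pt r' s t) (pt r0 s0 t0).
    apply: pt_close => //; rewrite -(subrKA r) (dyad_double p).
    by rewrite (le_lt_trans (ler_normD _ _))// ltrD// distrC.
  have := tame0 _ _ Fx Fy xy; have := tame1 _ _ Fx Fy xy.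
  rewrite !pt_m// !pt_m1// => h1 h0.
  by case: fst => /=; lra.
have [s0 [t0 [gs0 gt0 fs0 ft0]]] : exists s t, [/\ good s, good t,
    1 / 3 < `|osc s - g.1| & 1 / 3 < `|osc t - g.2|].
  have [s [sd s1 sg]] := osc_far _ g.1 (@dyad_gt0 R p).
  have [t [td t1 tg]] := osc_far _ g.2 (@dyad_gt0 R p).
  by exists s, t.
have side (W W' : set H) : open_pos W -> open_pos W' -> disjoint_pos W W' ->
    (forall r' s t, ~ outside r' s t -> W (pt r' s t) \/ W' (pt r' s t)) ->
    W (pt r s0 t0) -> type W r.
  move=> oW oW' dWW' WW' Wr; exists g => r' s t r'01 r'r gs gt fst.
  have rr a : 0 <= a <= 1 -> `|(1 - a) * r + a * r' - r| < dyad p.+1.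
    move=> /andP[a0 a1]; rewrite (_ : _ - r = a * (r' - r)); last by lra.
    by rewrite normrM (le_lt_trans _ r'r)// ler_piMl// ger0_norm.
  have rr0 : `|r - r| < dyad p.+1 by rewrite subrr normr0 dyad_gt0.
  have conv (x a : R) : (1 - a) * x + a * x = x by lra.
  (* one of the two coordinates is far from the value of [g]: it is kept fixed
     while the other coordinate and the time vary *)
  case: fst => fst.
    have W1 : W (pt r s t0).
      apply: (segment_stays _ _ _ _ oW oW' dWW' _ _ Wr); do ?exact: pt_positive.
      move=> a a01; rewrite segment_pt// !conv; apply: WW'; apply: hg => //.
        exact: convex_good.
      by right.
    apply: (segment_stays _ _ _ _ oW oW' dWW' _ _ W1); do ?exact: pt_positive.
    move=> a a01; rewrite segment_pt// !conv; apply: WW'; apply: hg => //.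
    - exact: convex_unit.
    - exact: rr.
    - exact: convex_good.
    - by left.
  have W1 : W (pt r s0 t).
    apply: (segment_stays _ _ _ _ oW oW' dWW' _ _ Wr); do ?exact: pt_positive.
    move=> a a01; rewrite segment_pt// !conv; apply: WW'; apply: hg => //.
      exact: convex_good.
    by left.
  apply: (segment_stays _ _ _ _ oW oW' dWW' _ _ W1); do ?exact: pt_positive.
  move=> a a01; rewrite segment_pt// !conv; apply: WW'; apply: hg => //.
  - exact: convex_unit.
  - exact: rr.
  - exact: convex_good.
  - by right.
have UV r' s t : ~ outside r' s t -> U (pt r' s t) \/ V (pt r' s t).
  by move=> /not_andP[]/contrapT; [left|right].
have [] : U (pt r s0 t0) \/ V (pt r s0 t0).
- by apply: UV; apply: hg => //; [rewrite subrr normr0 dyad_gt0|left].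
- by move=> Ur; left; apply: (side U V) => //; exact: UV.
- move=> Vr; right; apply: (side V U) => //; last by move=> r' s t /UV[]; [right|left].
  by move=> x px Vx Ux; exact: dUV Ux Vx.
Qed.

Lemma grid_false : False.
Proof.
have [K [K0 hK]] : exists K, (0 < K)%N /\ K%:R^-1 < dyad p.+1 :> R.
  exists (Num.truncn (dyad p.+1 : R)^-1).+1; split=> //.
  by rewrite invf_plt ?posrE ?dyad_gt0// truncnS_gt.
have K0R : 0 < K%:R :> R by rewrite ltr0n.
have kK (k : nat) : (k <= K)%N -> unit_itv (k%:R / K%:R).
  by move=> kK; rewrite /unit_itv divr_ge0//= ler_pdivrMr// mul1r ler_nat.
have typeU k : (k <= K)%N -> type U (k%:R / K%:R).
  elim: k => [_|k ih kltK].
    have [//|[g hg]] := type_total _ (kK 0%N isT).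
    have [s [t [gs gt fst _]]] := two_good g g.
    have r0 : unit_itv 0 by rewrite /unit_itv lexx ler01.
    exfalso; apply: (dUV (pt 0 s t)); first exact: pt_positive.
      apply: Uu; first exact: pt_positive.
      by move=> i im; rewrite pt_lo// subr0 mul1r mul0r addr0 subrr normr0 dyad_gt0.
    by apply: hg => //; rewrite mul0r subrr normr0 dyad_gt0.
  have [//|Vk] := type_total _ (kK _ kltK).
  exfalso; apply: (type_disjoint _ _ (kK _ (ltnW kltK)) _ (ih (ltnW kltK)) Vk).
  rewrite -mulrBl -natr1 opprD addrA subrr sub0r mulN1r normrN.
  by rewrite ger0_norm// invr_ge0 ltW.
have [g hg] := typeU _ (leqnn K).
have [s [t [gs gt fst _]]] := two_good g g.
have r1 : unit_itv 1 by rewrite /unit_itv lexx ler01.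
apply: (dUV (pt 1 s t)); first exact: pt_positive.
  by apply: hg => //; rewrite divff ?gt_eqF// subrr normr0 dyad_gt0.
apply: Vv; first exact: pt_positive.
by move=> i im; rewrite pt_lo// subrr mul1r mul0r add0r subrr normr0 dyad_gt0.
Qed.

End grid.

(** A tame set does not contain, within a cylinder, all the points separating
    two disjoint open sets that meet this cylinder. *)
Lemma separator_not_tame U V F N c u v :
  open_pos U -> open_pos V -> disjoint_pos U V -> tame F ->
  positive u -> positive v -> cyl N c u -> cyl N c v -> U u -> V v ->
  exists x, [/\ positive x, cyl N c x, ~ U x, ~ V x & ~ F x].
Proof.
move=> oU oV dUV tF pu pv cu cv Uu Vv; apply: contrapT => no.
have [n1 h1] := oU _ pu Uu; have [n2 h2] := oV _ pv Vv.
pose m := maxn N (maxn n1 n2).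
have [p0 t0] := tF m; have [p1 t1] := tF m.+1.
apply: (@grid_false U V F N c u v m (maxn p0 p1)) => //.
- by rewrite leq_maxl.
- move=> y py uy; apply: h1 => //; apply: cyl_le uy.
  by rewrite /m !leq_max leqnn orbT.
- move=> y py vy; apply: h2 => //; apply: cyl_le vy.
  by rewrite /m !leq_max leqnn !orbT.
- move=> x px cx nU nV; apply: contrapT => nF.
  by apply: no; exists x; split.
- by move=> x y Fx Fy xy; apply: t0 => //; apply: cyl_le xy; rewrite leq_maxl.
- by move=> x y Fx Fy xy; apply: t1 => //; apply: cyl_le xy; rewrite leq_maxr.
Qed.

End core.

(** * Boundaries are not countable unions of tame closed sets *)

Section category.
Context {R : realType}.
Local Notation H := (hilbert_cube R).
Implicit Types (x y z c : H) (U V F A : set H).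

(** The exterior of [U] relative to [positive]. *)
Definition exterior U : set H :=
  [set x | exists n, forall y, positive y -> cyl n x y -> ~ U y].

Lemma open_exterior U : open_pos (exterior U).
Proof.
move=> x px [n hn]; exists n.+1 => y py xy; exists n.+1 => z pz yz.
by apply: hn => //; exact: cyl_trans xy yz.
Qed.

Lemma sub_exterior U V : open_pos U -> disjoint_pos U V ->
  forall x, positive x -> U x -> exterior V x.
Proof.
move=> oU dUV x px /(oU _ px)[n hn]; exists n => y py xy Vy.
by apply: (dUV y) => //; exact: hn.
Qed.

(** A sequence of cylinders, each compactly contained in the previous one, has
    a common point. *)
Lemma nested_cylinders (c : nat -> H) (N : nat -> nat) :
  (forall k, (k <= N k)%N) ->
  (forall k y, cyl (N k.+1).-1 (c k.+1) y -> cyl (N k) (c k) y) ->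
  exists x, forall k, cyl (N k) (c k) x.
Proof.
move=> kN step.
have pred k y : cyl (N k) (c k) y -> cyl (N k).-1 (c k) y.
  by apply: cyl_le; rewrite leq_pred.
have nest k j y : cyl (N (j + k)%N) (c (j + k)%N) y -> cyl (N k) (c k) y.
  elim: j => [//|j ih]; rewrite addSn => h; apply: ih; apply: step; exact: pred.
have nest_le k l y : (k <= l)%N -> cyl (N l) (c l) y -> cyl (N k) (c k) y.
  by move=> /subnK <-; exact: nest.
(* each coordinate of the common point is the supremum of the lower ends of the
   corresponding sides of the cylinders *)
pose lo i := [set t : R | exists k, (i < N k)%N /\ t = (c k i)%:num - dyad (N k)].
have lo_le i k l : (i < N k)%N -> (i < N l)%N ->
    (c k i)%:num - dyad (N k) <= (c l i)%:num + dyad (N l).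
  move=> ik il.
  have h1 := nest_le _ _ _ (leq_maxl k l) (cyl_refl _ _) i ik.
  have h2 := nest_le _ _ _ (leq_maxr k l) (cyl_refl _ _) i il.
  by move: h1 h2; rewrite !ltr_norml => /andP[? ?] /andP[? ?]; lra.
have sup_lo i k : (i < N k)%N -> `|(c k i)%:num - sup (lo i)| <= dyad (N k).
  move=> ik.
  have ub : ubound (lo i) ((c k i)%:num + dyad (N k)).
    by move=> _ [l [il ->]]; exact: lo_le.
  have h1 : sup (lo i) <= (c k i)%:num + dyad (N k).
    by apply: ge_sup ub; exists ((c k i)%:num - dyad (N k)), k.
  have h2 : (c k i)%:num - dyad (N k) <= sup (lo i).
    apply: ub_le_sup; last by exists k.
    by exists ((c k i)%:num + dyad (N k)).
  by rewrite ler_norml; apply/andP; split; lra.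
have lo01 i : 0 <= sup (lo i) <= 1.
  have bnd k : (i < N k)%N -> - dyad (N k) <= sup (lo i) <= 1 + dyad (N k).
    move=> /sup_lo; rewrite ler_norml => /andP[h1 h2].
    have c0 : 0 <= (c k i)%:num by []; have c1 : (c k i)%:num <= 1 by [].
    by apply/andP; split; lra.
  have small (e : R) : 0 < e -> - e <= sup (lo i) <= 1 + e.
    move=> /dyad_lt_ex[n hn].
    have := bnd (maxn n i.+1) (leq_trans (leq_maxr _ _) (kN _)).
    have := dyad_le (R := R) n _ (leq_trans (leq_maxl n i.+1) (kN (maxn n i.+1))).
    by move=> h /andP[? ?]; apply/andP; split; lra.
  apply/andP; split; apply/ler_addgt0Pr => e e0; have /andP[? ?] := small e e0;
    by lra.
exists (fun i => clamp (sup (lo i))) => k.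
apply: step => i ik; rewrite clampE//.
have ik' : (i < N k.+1)%N by apply: leq_trans ik _; rewrite leq_pred.
apply: le_lt_trans (sup_lo _ _ ik') _.
have N0 : (0 < N k.+1)%N by exact: leq_ltn_trans (kN k.+1).
by rewrite -{1}(prednK N0) [ltRHS]dyad_double ltrDl dyad_gt0.
Qed.

(** The Baire category argument: a cylinder that meets two disjoint open sets
    contains a point outside them that avoids countably many given tame closed
    sets. *)
Lemma separator_baire U V (F : nat -> set H) N c u v :
  open_pos U -> open_pos V -> disjoint_pos U V ->
  (forall n, tame (F n)) -> (forall n, closed_pos (F n)) ->
  positive u -> positive v -> cyl N c u -> cyl N c v -> U u -> V v ->
  exists x, [/\ positive x, cyl N c x, ~ U x, ~ V x & forall n, ~ F n x].
Proof.
move=> oU oV dUV tF cF pu pv cu cv Uu Vv.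
(* the two open sets are enlarged so that they have the same boundary *)
pose V1 := exterior U; pose U1 := exterior V1.
have oV1 : open_pos V1 by exact: open_exterior.
have oU1 : open_pos U1 by exact: open_exterior.
have dU1V1 : disjoint_pos U1 V1.
  by move=> x px [n /(_ _ px (cyl_refl _ _))].
have UU1 x : positive x -> U x -> U1 x.
  apply: sub_exterior => // y py Uy [n /(_ _ py (cyl_refl _ _))]; exact.
have VV1 x : positive x -> V x -> V1 x.
  by apply: sub_exterior => // y py Vy Uy; exact: dUV Uy Vy.
pose meets k x := exists y z,
  [/\ positive y, positive z, cyl k x y /\ cyl k x z, U1 y & V1 z].
have boundary_meets k x : positive x -> ~ U1 x -> ~ V1 x -> meets k x.
  move=> px nU1 nV1.
  have [y [py xy Uy]] : exists y, [/\ positive y, cyl k x y & U y].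
    apply: contrapT => no; apply: nV1; exists k => y py xy Uy.
    by apply: no; exists y.
  have [z [pz xz Vz]] : exists z, [/\ positive z, cyl k x z & V1 z].
    apply: contrapT => no; apply: nU1; exists k => z pz xz Vz.
    by apply: no; exists z.
  by exists y, z; split=> //; exact: UU1.
have next n x k : meets k x -> exists y l, [/\ meets l y, (k < l)%N,
    forall z, cyl l.-1 y z -> cyl k x z,
    forall z, cyl l y z -> 0 < (z n)%:num &
    forall z, positive z -> cyl l y z -> ~ F n z].
  move=> [a [b [pa pb [xa xb] Ua Vb]]].
  have [y [py xy nU nV nF]] := separator_not_tame _ _ _ _ _ _ _ oU1 oV1 dU1V1
    (tF n) pa pb xa xb Ua Vb.
  have [l1 h1] := cyl_interior _ _ _ xy.
  have [l2 h2] := cF n _ py nF.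
  have [l3 h3] := dyad_lt_ex _ (py n).
  pose l := (maxn (maxn k l1) (maxn l2 (maxn l3 n))).+1.
  have kl : (k <= l.-1)%N by rewrite /l /= !leq_max leqnn.
  have l1l : (l1 <= l.-1)%N by rewrite /l /= !leq_max leqnn !orbT.
  have l2l : (l2 <= l.-1)%N by rewrite /l /= !leq_max leqnn !orbT.
  have l3l : (l3 <= l.-1)%N by rewrite /l /= !leq_max leqnn !orbT.
  have nl : (n <= l.-1)%N by rewrite /l /= !leq_max leqnn !orbT.
  exists y, l; split.
  - exact: boundary_meets.
  - by [].
  - by move=> z yz; apply: h1; apply: cyl_le yz.
  - move=> z yz; have := yz n nl; have := dyad_le (R := R) l3 l (leq_trans l3l (leq_pred _)).
    by rewrite ltr_norml => h /andP[h4 h5]; lra.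
  - by move=> z pz yz; apply: h2 => //; apply: cyl_le yz; rewrite (leq_trans l2l)// leq_pred.
(* a state consists of the index of the next tame set to avoid, and of the
   centre and the radius index of the current cylinder *)
pose S := {q : nat * H * nat | meets q.2 q.1.2}.
pose step (q q' : S) := [/\ (sval q').1.1 = (sval q).1.1.+1,
    ((sval q).2 < (sval q').2)%N,
    forall z, cyl (sval q').2.-1 (sval q').1.2 z -> cyl (sval q).2 (sval q).1.2 z,
    forall z, cyl (sval q').2 (sval q').1.2 z -> 0 < (z (sval q).1.1)%:num &
    forall z, positive z -> cyl (sval q').2 (sval q').1.2 z -> ~ F (sval q).1.1 z].
have stepP q : {q' | step q q'}.
  apply: cid; case: q => -[[n x] k] mq.
  have [y [l [m h1 h2 h3 h4]]] := next n x k mq.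
  by exists (exist _ (n.+1, y, l) m); split.
have m0 : meets N c.
  by exists u, v; split=> //; [exact: UU1|exact: VV1].
have [s [s0 hs]] := dependent_choice stepP (exist _ (0%N, c, N) m0).
have idx k : (sval (s k)).1.1 = k.
  by elim: k => [|k ih]; [rewrite s0|case: (hs k) => ->; rewrite ih].
have [|k y|x hx] := nested_cylinders (fun k => (sval (s k)).1.2) (fun k => (sval (s k)).2).
- by elim=> // k ih; case: (hs k) => _ h _ _ _; exact: leq_ltn_trans h.
- by case: (hs k) => _ _ h _ _; exact: h.
have px : positive x.
  by move=> i; case: (hs i) => _ _ _ + _; rewrite idx; apply; exact: hx.
have big k : exists l, (k < (sval (s l)).2)%N.
  elim: k => [|k [l hl]].
    by exists 1%N; case: (hs 0%N) => _ h _ _ _; exact: leq_ltn_trans h.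
  by exists l.+1; case: (hs l) => _ h _ _ _; exact: leq_ltn_trans h.
have close (W W' : set H) : open_pos W -> disjoint_pos W W' ->
    (forall k, exists y, [/\ positive y, cyl (sval (s k)).2 (sval (s k)).1.2 y & W' y]) ->
    ~ W x.
  move=> oW dWW' mW' Wx; have [k hk] := oW _ px Wx.
  have [l hl] := big k.
  have [y [py xy W'y]] := mW' l.
  apply: (dWW' y) => //; apply: hk => //.
  apply: (@cyl_trans _ _ _ (sval (s l)).1.2); last exact: cyl_le xy.
  by apply: cyl_sym; apply: cyl_le (hx l).
have nU1 : ~ U1 x.
  apply: (close _ V1) => // k.
  have [y [z [py pz [xy xz] Uy Vz]]] := svalP (s k).
  by exists z.
have nV1 : ~ V1 x.
  apply: (close _ U1) => // [z pz Vz Uz|k]; first exact: dU1V1 Uz Vz.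
  have [y [z [py pz [xy xz] Uy Vz]]] := svalP (s k).
  by exists y.
exists x; split=> //.
- by have := hx 0%N; rewrite s0.
- by move=> /(UU1 _ px).
- by move=> /(VV1 _ px).
- by move=> n; case: (hs n) => _ _ _ _; rewrite idx; apply=> //; exact: hx.
Qed.

(** Relative to [positive], the sigma-ideal generated by the tame closed
    sets. *)
Definition sigma_tame A := exists F : nat -> set H,
  [/\ forall n, tame (F n), forall n, closed_pos (F n) &
      forall x, positive x -> A x -> exists n, F n x].

Lemma sigma_tame_sub A B : A `<=` B -> sigma_tame B -> sigma_tame A.
Proof.
by move=> AB [F [tF cF BF]]; exists F; split=> // x px /AB; exact: BF.
Qed.

Lemma sigma_tameU A B : sigma_tame A -> sigma_tame B -> sigma_tame (A `|` B).
Proof.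
move=> [F [tF cF AF]] [G [tG cG BG]].
exists (fun n => if odd n then F n./2 else G n./2); split.
- by move=> n; case: ifP.
- by move=> n; case: ifP.
move=> x px [/(AF _ px)[n Fx]|/(BG _ px)[n Gx]].
  by exists n.*2.+1; rewrite /= odd_double uphalf_double.
by exists n.*2; rewrite odd_double doubleK.
Qed.

Lemma separator_not_sigma_tame U V u v :
  open_pos U -> open_pos V -> disjoint_pos U V ->
  positive u -> positive v -> U u -> V v -> ~ sigma_tame (~` (U `|` V)).
Proof.
move=> oU oV dUV pu pv Uu Vv [F [tF cF hF]].
have [x [px _ nU nV nF]] := separator_baire _ _ _ 0 u _ _ oU oV dUV tF cF pu pv
  (cyl_refl _ _) (fun i => ltac:(by [])) Uu Vv.
have [|n] := hF x px; first by move=> [].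
exact: nF.
Qed.

(** The points of the cylinder on either side of a hyperplane orthogonal to the
    first axis are separated by this hyperplane. *)
Lemma cylinder_not_sigma_tame N c : positive c -> ~ sigma_tame (cyl N c).
Proof.
move=> pc [F [tF cF hF]].
have c00 : 0 < (c 0)%:num by exact: pc.
have c01 : (c 0)%:num <= 1 by [].
have r0 := @dyad_gt0 R N.+1; have r1 := @dyad_le1 R N.+1.
pose c' : H := fun i => if i == 0%N then clamp ((c 0)%:num * (1 - dyad N.+1 / 2)) else c i.
have c'E : (c' 0)%:num = (c 0)%:num * (1 - dyad N.+1 / 2).
  by rewrite /c' eqxx clampE//; apply/andP; split; nra.
have c'lt : (c' 0)%:num < (c 0)%:num by rewrite c'E; nra.
pose a := ((c' 0)%:num + (c 0)%:num) / 2.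
pose U := [set x : H | (x 0)%:num < a]; pose V := [set x : H | a < (x 0)%:num].
have oU : open_pos U.
  move=> x px; rewrite /U/= => xa.
  have [n hn] := dyad_lt_ex (a - (x 0)%:num) ltac:(by rewrite subr_gt0).
  exists n.+1 => y _ /(_ 0 isT); have := dyad_double (R := R) n.
  by have := @dyad_gt0 R n.+1; rewrite ltr_norml => ? ? /andP[? ?]; lra.
have oV : open_pos V.
  move=> x px; rewrite /V/= => xa.
  have [n hn] := dyad_lt_ex ((x 0)%:num - a) ltac:(by rewrite subr_gt0).
  exists n.+1 => y _ /(_ 0 isT); have := dyad_double (R := R) n.
  by have := @dyad_gt0 R n.+1; rewrite ltr_norml => ? ? /andP[? ?]; lra.
have dUV : disjoint_pos U V by move=> x _; rewrite /U /V/=; lra.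
have pc' : positive c'.
  move=> i; case: (eqVneq i 0%N) => [->|i0]; first by rewrite c'E; nra.
  by rewrite /c' (negbTE i0); exact: pc.
have cc' : cyl N c c'.
  move=> i _; case: (eqVneq i 0%N) => [->|i0].
    rewrite c'E (dyad_double N) ger0_norm; nra.
  by rewrite /c' (negbTE i0) subrr normr0 dyad_gt0.
have Uc' : U c' by change ((c' 0)%:num < a); rewrite /a; lra.
have Vc : V c by change (a < (c 0)%:num); rewrite /a; lra.
have [x [px cx _ _ nF]] := separator_baire _ _ _ _ _ _ _ oU oV dUV tF cF pc' pc
  cc' (cyl_refl _ _) Uc' Vc.
by have [n] := hF x px cx; exact: nF.
Qed.

End category.

(** * Real functions have large fibres *)

Section fibres.
Context {R : realType}.
Local Notation H := (hilbert_cube R).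
Implicit Types (x y z : H) (c : R) (D : nat -> H) (h : nat -> R).

(** The closure of the range of [D]. *)
Definition adherent D : set H := [set x | forall n, exists k, cyl n x (D k)].

(** [converges D h c x]: the point [x] is a limit of the sequence [D], and the
    function sending [D k] to [h k] has limit [c] at [x]. *)
Definition converges D h c x :=
  adherent D x /\
  forall e : R, 0 < e -> exists n, forall k, cyl n x (D k) -> `|h k - c| < e.

Lemma converges_unique D h c c' x :
  converges D h c x -> converges D h c' x -> c = c'.
Proof.
move=> [Dx hx] [_ hx']; apply/eqP; rewrite -subr_eq0 -normr_le0.
apply/ler_addgt0Pr => e e0; rewrite add0r.
have [n hn] := hx (e / 2) ltac:(by rewrite divr_gt0).
have [n' hn'] := hx' (e / 2) ltac:(by rewrite divr_gt0).
have [k xk] := Dx (maxn n n').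
have := hn k (cyl_le _ _ _ _ (leq_maxl _ _) xk).
have := hn' k (cyl_le _ _ _ _ (leq_maxr _ _) xk).
rewrite !ltr_norml ler_norml => /andP[? ?] /andP[? ?].
by apply/andP; split; lra.
Qed.

Definition diverges D h x := ~ exists c, converges D h c x.

(** A function defined and continuous outside a set of the ideal has a fibre
    outside the ideal: otherwise its sublevel and superlevel sets at some value
    are separated only by a fibre and an exceptional set. *)
Lemma large_fibre D h : sigma_tame (diverges D h) ->
  exists c, ~ sigma_tame (converges D h c).
Proof.
move=> tB; apply: contrapT => no.
have tT c : sigma_tame (converges D h c).
  by apply: contrapT => nT; apply: no; exists c.
have dense x n : positive x -> exists k, cyl n x (D k).
  move=> px; apply: contrapT => nD.
  apply: (cylinder_not_sigma_tame n.+1 x px); apply: sigma_tame_sub tB => y xy.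
  move=> [c [/(_ n.+1)[k yk] _]]; apply: nD; exists k; exact: cyl_trans xy yk.
pose below c := [set x : H | exists n e, 0 < e /\
  forall k, cyl n x (D k) -> h k <= c - e].
pose above c := [set x : H | exists n e, 0 < e /\
  forall k, cyl n x (D k) -> c + e <= h k].
have oU c : open_pos (below c).
  move=> x px [n [e [e0 hn]]]; exists n.+1 => y py xy; exists n.+1, e.
  by split=> // k yk; apply: hn; exact: cyl_trans xy yk.
have oV c : open_pos (above c).
  move=> x px [n [e [e0 hn]]]; exists n.+1 => y py xy; exists n.+1, e.
  by split=> // k yk; apply: hn; exact: cyl_trans xy yk.
have dUV c : disjoint_pos (below c) (above c).
  move=> x px [n [e [e0 hn]]] [n' [e' [e'0 hn']]].
  have [k xk] := dense x (maxn n n') px.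
  have := hn k (cyl_le _ _ _ _ (leq_maxl _ _) xk).
  by have := hn' k (cyl_le _ _ _ _ (leq_maxr _ _) xk); lra.
have cvg_below c c' x : converges D h c' x -> c' < c -> below c x.
  move=> [_ hx] cc'.
  have [|n hn] := hx ((c - c') / 2); first by rewrite divr_gt0// subr_gt0.
  exists n, ((c - c') / 2); split; first by rewrite divr_gt0// subr_gt0.
  by move=> k /hn; rewrite ltr_norml => /andP[? ?]; lra.
have cvg_above c c' x : converges D h c' x -> c < c' -> above c x.
  move=> [_ hx] cc'.
  have [|n hn] := hx ((c' - c) / 2); first by rewrite divr_gt0// subr_gt0.
  exists n, ((c' - c) / 2); split; first by rewrite divr_gt0// subr_gt0.
  by move=> k /hn; rewrite ltr_norml => /andP[? ?]; lra.
have not_both c x y : positive x -> positive y -> below c x -> above c y -> False.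
  move=> px py bx ay.
  apply: (separator_not_sigma_tame _ _ _ _ (oU c) (oV c) (dUV c) px py bx ay).
  apply: sigma_tame_sub (sigma_tameU _ _ tB (tT c)) => z /not_orP[nb na].
  have [[c' cz]|nz] := pselect (exists c', converges D h c' z); last by left.
  right; have [cc'|cc'|<-//] := ltgtP c' c.
    by case: nb; exact: cvg_below cz cc'.
  by case: na; exact: cvg_above cz cc'.
pose one : H := fun=> clamp 1.
have p1 : positive one by move=> i; rewrite clampE ?ltr01// ler01 lexx.
have [c0 hc0] : exists c0, exists2 y, positive y & converges D h c0 y.
  apply: contrapT => nc; apply: (cylinder_not_sigma_tame 0 one p1).
  have [F [tF cF hF]] := tB; exists F; split=> // x px _; apply: hF => //.
  by move=> [c xc]; apply: nc; exists c; exists x.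
have [y py yc0] := hc0.
have [F [tF cF hF]] := sigma_tameU _ _ tB (tT c0).
apply: (cylinder_not_sigma_tame 0 one p1); exists F; split=> // x px _.
apply: hF => //.
have [[c xc]|nz] := pselect (exists c, converges D h c x); last by left.
right; have [cc|cc|<-//] := ltgtP c c0.
  exfalso; apply: (not_both ((c + c0) / 2) x y) => //.
    by apply: cvg_below xc _; lra.
  by apply: cvg_above yc0 _; lra.
exfalso; apply: (not_both ((c + c0) / 2) y x) => //.
  by apply: cvg_below yc0 _; lra.
by apply: cvg_above xc _; lra.
Qed.

End fibres.

(** * Transfinite constructions under the continuum hypothesis *)

Lemma uncountable_set_nat : ~ countable [set: set nat].
Proof.
move=> /countable_injP[f fI].
pose A : set nat := [set n | exists2 B : set nat, f B = n & ~ B n].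
have nA : ~ A (f A).
  by move=> /[dup] AfA [B fBA nB]; apply: nB; rewrite (fI B A) ?inE.
by apply: (nA); exists A.
Qed.

Lemma countable_preimage T U (f : T -> U) (A : set T) (B : set U) :
  injective f -> f @` A `<=` B -> countable B -> countable A.
Proof.
move=> fI AB /countable_injP[g gI]; apply/countable_injP; exists (g \o f).
move=> x y /set_mem Ax /set_mem Ay /gI/fI; apply; apply/mem_set/AB.
  by exists x.
by exists y.
Qed.

Lemma countable_setU T (A B : set T) :
  countable A -> countable B -> countable (A `|` B).
Proof.
move=> cA cB; rewrite -bigcup2E; apply: bigcup_countable => //.
by move=> [|[|n]] _ //=; exact: countable0.
Qed.

(** [T] has at most the cardinality of the continuum. *)
Definition sub_continuum (T : Type) := exists f : T -> set nat, injective f.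

Lemma sub_continuum_inj T U (f : T -> U) :
  injective f -> sub_continuum U -> sub_continuum T.
Proof. by move=> fI [g gI]; exists (g \o f); exact: inj_comp. Qed.

Lemma sub_continuum_bool : sub_continuum bool.
Proof.
exists (fun b => [set n | b]) => -[] [] // /seteqP[h1 h2].
  by have := h1 0%N isT.
by have := h2 0%N isT.
Qed.

Lemma sub_continuum_prod T U :
  sub_continuum T -> sub_continuum U -> sub_continuum (T * U).
Proof.
move=> [f fI] [g gI].
exists (fun p => [set n | if odd n then f p.1 n./2 else g p.2 n./2]).
move=> [a b] [a' b'] /seteqP[/= h1 h2]; congr pair.
  apply/fI/seteqP; split=> n.
    by have := h1 n.*2.+1; rewrite /= odd_double uphalf_double.
  by have := h2 n.*2.+1; rewrite /= odd_double uphalf_double.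
apply/gI/seteqP; split=> n.
  by have := h1 n.*2; rewrite /= odd_double doubleK.
by have := h2 n.*2; rewrite /= odd_double doubleK.
Qed.

Lemma sub_continuum_seq T : sub_continuum T -> sub_continuum (nat -> T).
Proof.
move=> [f fI].
exists (fun s => [set n | exists i j, n = pickle (i, j) /\ f (s i) j]).
move=> s t /seteqP[/= h1 h2]; apply/funext => i; apply/fI/seteqP; split=> j h.
  have [|i' [j' [/(pcan_inj pickleK)[-> ->]]]//] := h1 (pickle (i, j)).
  by exists i, j.
have [|i' [j' [/(pcan_inj pickleK)[-> ->]]]//] := h2 (pickle (i, j)).
by exists i, j.
Qed.

(** Dedekind cuts. *)
Lemma sub_continuum_real (R : realType) : sub_continuum R.
Proof.
exists (fun x : R => [set n | exists q : rat, n = pickle q /\ ratr q < x]).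
have le (x y : R) : [set n | exists q : rat, n = pickle q /\ ratr q < x] `<=`
    [set n | exists q : rat, n = pickle q /\ ratr q < y] -> x <= y.
  move=> h; rewrite leNgt; apply/negP => /rat_in_itvoo[q].
  rewrite in_itv/= => /andP[yq qx].
  have [|q' [/(pcan_inj pickleK)<-]] := h (pickle q); first by exists q.
  by rewrite ltNge ltW.
by move=> x y /seteqP[/le xy /le yx]; apply/eqP; rewrite eq_le xy.
Qed.

Lemma sub_continuum_surj T (t0 : T) : sub_continuum T ->
  exists s : set nat -> T, forall t, exists a, s a = t.
Proof.
move=> [f fI].
exists (fun a => if pselect (exists t, f t = a) is left h then sval (cid h) else t0).
move=> t; exists (f t); case: pselect => [h|[]]; last by exists t.
exact: fI (svalP (cid h)).
Qed.

(** Under the continuum hypothesis, a subset of a set of cardinality at most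
    that of the continuum has exactly this cardinality if it is uncountable. *)
Lemma uncountable_continuum T (A : set T) : continuum_hypothesis ->
  sub_continuum T -> ~ countable A -> has_card_continuum A.
Proof.
move=> CH [f fI] nA.
have AfA : (f @` A #= A)%card by apply: inj_card_eq => x y _ _; exact: fI.
have [cA|fA] := CH (f @` A).
  by exfalso; apply: nA; rewrite -(eq_countable AfA).
exact: card_eq_trans (card_esym AfA) fA.
Qed.

Lemma continuum_uncountable T (A : set T) : has_card_continuum A -> ~ countable A.
Proof. by move=> /eq_countable ->; exact: uncountable_set_nat. Qed.

(** Under the continuum hypothesis, the power set of [nat] has a well-ordering
    with countable initial segments. *)
Lemma continuum_well_order : continuum_hypothesis ->
  exists lt : set nat -> set nat -> Prop,
    [/\ well_founded lt, forall a b, [\/ lt a b, a = b | lt b a] &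
        forall a, countable [set b | lt b a]].
Proof.
move=> CH; have [r wo] := wochoice.well_ordering_principle (set nat).
have least (P : set nat -> Prop) : (exists a, P a) ->
    exists z, P z /\ forall x, P x -> r z x.
  move=> [a Pa].
  have [|z [[/asboolP Pz lez] _]] := wo (fun x => `[< P x >]).
    by exists a; apply/asboolP.
  by exists z; split=> // x Px; apply: lez; apply/asboolP.
have anti a b : r a b -> r b a -> a = b.
  move=> rab rba.
  have [|z [_ zu]] := wo (fun x => (x == a) || (x == b)).
    by exists a; rewrite unfold_in eqxx.
  have rr x : r x x.
    have [|y [/= -> yx]] := least (fun y => y = x); first by exists x.
    exact: yx.
  have <- : z = a.
    apply: zu; split; first by rewrite unfold_in eqxx.
    by move=> x; rewrite unfold_in => /orP[]/eqP->.
  apply: zu; split; first by rewrite unfold_in eqxx orbT.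
  by move=> x; rewrite unfold_in => /orP[]/eqP->.
pose lt0 a b := r a b /\ a <> b.
have wf0 : well_founded lt0.
  move=> a; apply: contrapT => na.
  have [|z [nz lez]] := least (fun x => ~ Acc lt0 x); first by exists a.
  apply: nz; constructor => y [ryz yz]; apply: contrapT => ny.
  by apply: yz; apply: anti => //; exact: lez.
have tot0 a b : [\/ lt0 a b, a = b | lt0 b a].
  have [->|ab] := pselect (a = b); first by constructor 2.
  have [|z [[->|->] lez]] := least (fun x => x = a \/ x = b).
  - by exists a; left.
  - by constructor 1; split=> //; apply: lez; right.
  - by constructor 3; split; [apply: lez; left|exact/nesym].
pose seg a := [set b | lt0 b a].
have [[a0 na0]|all] := pselect (exists a, ~ countable (seg a)); last first.
  exists lt0; split=> // a; apply: contrapT => na; apply: all; by exists a.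
have [|a [na lea]] := least (fun a => ~ countable (seg a)); first by exists a0.
have : ([set: set nat] #= seg a)%card.
  apply: card_esym; apply: uncountable_continuum => //.
  by exists id; exact: inj_id.
move=> /card_set_bijP[f [fseg fI _]].
have {}fI : injective f by move=> x y; apply: fI; rewrite inE.
exists (fun x y => lt0 (f x) (f y)); split.
- move=> x; move: {2}(f x) (erefl (f x)) => z; move: x.
  elim/(well_founded_ind wf0): z => z ih x xz; constructor => y yx.
  by apply: ih (erefl _); rewrite -xz.
- move=> x y; have [h|/fI h|h] := tot0 (f x) (f y).
  + by constructor 1.
  + by constructor 2.
  + by constructor 3.
- move=> y; apply: (@countable_preimage _ _ f _ (seg (f y))) => //.
    by move=> _ [x /= xy <-].
  apply: contrapT => /lea ray; have [rya ya] := fseg y I.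
  by apply: ya; exact: anti.
Qed.

(** A Luzin-type construction. The set [E] is enumerated by a transfinite
    sequence of length omega_1; each point is chosen in a prescribed target,
    outside the sets [S m] met so far, and every target is prescribed
    uncountably often. *)
Lemma luzin_set (T K M : Type) (S : M -> set T) (G : K -> set T) (k0 : K) (m0 : M) :
  continuum_hypothesis -> sub_continuum K -> sub_continuum M ->
  (forall k (C : set M), countable C ->
    exists x, G k x /\ forall m, C m -> ~ S m x) ->
  (forall k x, G k x -> exists m, S m x) ->
  exists E : set T, [/\ forall x, E x -> exists k, G k x,
    forall m, countable (E `&` S m) & forall k, ~ countable (E `&` G k)].
Proof.
move=> CH cK cM avoid cover.
have [lt [wf tot seg]] := continuum_well_order CH.
have [sg sgP] := sub_continuum_surj _ m0 cM.
have [ta taP] := sub_continuum_surj _ (k0, set0)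
  (sub_continuum_prod _ _ cK (ex_intro _ id (@inj_id (set nat)))).
have [t0 _] := avoid k0 set0 (countable0 _).
have [mm mmP] : exists mm : T -> M, forall k x, G k x -> S (mm x) x.
  exists (fun x => if pselect (exists m, S m x) is left h then sval (cid h) else m0).
  move=> k x Gx; case: pselect => [h|[]]; first exact: svalP (cid h).
  exact: cover Gx.
have step a (x : set nat -> T) : exists y, G (ta a).1 y /\
    forall b, lt b a -> ~ S (sg b) y /\ ~ S (mm (x b)) y.
  have [|y [Gy yC]] := avoid (ta a).1
      (sg @` [set b | lt b a] `|` (mm \o x) @` [set b | lt b a]).
    by apply: countable_setU; exact: sub_countable (card_image_le _ _) (seg a).
  exists y; split=> // b ba; split; apply: yC; [left|right]; by exists b.
pose next a (rec : forall b, lt b a -> T) : T := sval (cid (step a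
  (fun b => if pselect (lt b a) is left h then rec b h else t0))).
pose x := Fix wf (fun=> T) next.
have xE a : x a = next a (fun b _ => x b).
  rewrite /x Fix_eq// => b f g fg; congr next.
  by apply: functional_extensionality_dep => c;
     apply: functional_extensionality_dep => h.
have xP a : G (ta a).1 (x a) /\
    forall b, lt b a -> ~ S (sg b) (x a) /\ ~ S (mm (x b)) (x a).
  rewrite xE; have [Gx hx] := svalP (cid (step a
    (fun b => if pselect (lt b a) is left h then x b else t0))).
  by split=> // b ba; have := hx b ba; case: pselect.
have xlt a b : lt a b -> x a <> x b.
  move=> ab xab; have [_ /(_ _ ab)[_]] := xP b; apply.
  by rewrite xab; apply: mmP; exact: (xP b).1.
have xI : injective x.
  by move=> a b xab; have [/xlt|//|/xlt/nesym] := tot a b.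
exists (range x); split.
- by move=> _ [a _ <-]; exists (ta a).1; exact: (xP a).1.
- move=> m; have [b <-] := sgP m.
  apply: (@sub_countable _ _ _ (x @` ([set a | lt a b] `|` [set b]))); last first.
    apply: sub_countable (card_image_le _ _) _.
    by apply: countable_setU; [exact: seg|exact: countable1].
  apply: subset_card_le => _ [[a _ <-] Sa]; exists a => //.
  have [ab|->|ba] := tot a b; [by left|by right|].
  by have [_ /(_ _ ba)[]] := xP a.
- move=> k ck; apply: uncountable_set_nat.
  have cA : countable [set a | (ta a).1 = k].
    apply: countable_preimage _ _ _ _ _ xI _ ck => _ [a /= ak <-]; split; first by exists a.
    by rewrite -ak; exact: (xP a).1.
  apply: (@sub_countable _ _ _ ((fun a => (ta a).2) @` [set a | (ta a).1 = k])).
    apply: subset_card_le => b _; have [a ab] := taP (k, b).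
    by exists a; rewrite /= ab.
  exact: sub_countable (card_image_le _ _) cA.
Qed.

(** * The Luzin-type set *)

Section closures.
Context {R : realType}.
Local Notation H := (hilbert_cube R).
Implicit Types (x y z : H) (A F : set H) (D : nat -> H).

Lemma sub_continuum_cube : sub_continuum H.
Proof.
apply: (@sub_continuum_inj _ (nat -> R) (fun x i => (x i)%:num)).
  move=> x y /= xy; apply/funext => i; apply/val_inj.
  exact: (congr1 (fun s : nat -> R => s i) xy).
exact/sub_continuum_seq/sub_continuum_real.
Qed.

Lemma tame_sub A F : A `<=` F -> tame F -> tame A.
Proof.
by move=> AF tF i; have [m hm] := tF i; exists m => x y /AF ? /AF ?; exact: hm.
Qed.

(** Every subset of the cube is separable. *)
Lemma dense_sequence A : A !=set0 ->
  exists D, (forall k, A (D k)) /\ A `<=` adherent D.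
Proof.
move=> [a Aa].
(* points with the same truncated coordinates at scale [n] are in a common
   cylinder; one point of [A] is chosen for each list of truncations *)
pose code n x := pickle (n, [seq Num.truncn ((x i)%:num * 2 ^+ n) | i <- iota 0 n]).
pose D k := if pselect (exists y, A y /\ exists n, code n y = k) is left h
  then sval (cid h) else a.
exists D; split.
  by move=> k; rewrite /D; case: pselect => // h; case: (svalP (cid h)).
move=> x Ax n; exists (code n x); rewrite /D.
case: pselect => [h|[]]; last by exists x; split=> //; exists n.
have [_ [n' /(pcan_inj pickleK)[-> trunc]]] := svalP (cid h).
set y := sval _ in trunc *.
move=> i ni.
have xy : Num.truncn ((x i)%:num * 2 ^+ n) = Num.truncn ((y i)%:num * 2 ^+ n).
  have := congr1 (nth 0%N ^~ i) trunc.
  by rewrite !(nth_map 0%N) ?size_iota// nth_iota.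
have p0 : 0 < 2 ^+ n :> R by rewrite exprn_gt0.
have x0 : 0 <= (x i)%:num * 2 ^+ n by rewrite mulr_ge0// ltW.
have y0 : 0 <= (y i)%:num * 2 ^+ n by rewrite mulr_ge0// ltW.
have := truncn_itv x0; have := truncn_itv y0; rewrite xy -natr1.
move=> /andP[y1 y2] /andP[x1 x2].
rewrite /dyad -[ltRHS]mul1r ltr_pdivlMr// -[X in _ * X](gtr0_norm p0) -normrM.
by rewrite mulrBl ltr_norml; apply/andP; split; lra.
Qed.

(** The closure in [positive] of the range of [D] when this range is tame, and
    the empty set otherwise. *)
Definition tame_closure D : set H :=
  [set x | [/\ positive x, tame (range D) & adherent D x]].

Lemma tame_tame_closure D : tame (tame_closure D).
Proof.
have [tD|ntD] := pselect (tame (range D)); last by exists 0%N => x y [].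
move=> i; have [m hm] := tD i.
exists m.+2 => x y [px _ Dx] [py _ Dy] xy; apply/ler_addgt0Pr => e e0.
have e2 : 0 < e / 2 by rewrite divr_gt0.
have [n hn] := osc_cyl x i (e / 2) px e2.
have [n' hn'] := osc_cyl y i (e / 2) py e2.
have [k xk] := Dx (maxn n m.+2); have [l yl] := Dy (maxn n' m.+2).
have h1 := hn _ (cyl_le _ _ _ _ (leq_maxl _ _) xk).
have h2 := hn' _ (cyl_le _ _ _ _ (leq_maxl _ _) yl).
have {}xk := cyl_le _ _ _ _ (leq_maxr _ _) xk.
have {}yl := cyl_le _ _ _ _ (leq_maxr _ _) yl.
have kl : cyl m (D k) (D l).
  apply: (@cyl_trans _ _ _ y); last by apply: cyl_le yl.
  exact: cyl_trans (cyl_sym _ _ _ xk) xy.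
have := hm (D k) (D l) ltac:(by exists k) ltac:(by exists l) kl.
move: h1 h2; rewrite !ltr_norml !ler_norml.
by move=> /andP[? ?] /andP[? ?] /andP[? ?]; apply/andP; split; lra.
Qed.

Lemma closed_tame_closure D : closed_pos (tame_closure D).
Proof.
move=> x px nx.
have [tD|ntD] := pselect (tame (range D)); last by exists 0%N => y _ _ [].
have [n hn] : exists n, forall k, ~ cyl n x (D k).
  apply: contrapT => no; apply: nx; split=> // n; apply: contrapT => nk.
  by apply: no; exists n => k xk; apply: nk; exists k.
exists n.+1 => y py xy [_ _ /(_ n.+1)[k yk]].
by apply: (hn k); exact: cyl_trans xy yk.
Qed.

Lemma tame_closure_const x : positive x -> tame_closure (fun=> x) x.
Proof.
move=> px; split=> // [i|n]; last by exists 0%N; exact: cyl_refl.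
by exists 0%N => _ _ [_ _ <-] [_ _ <-] _; rewrite subrr normr0 divr_ge0.
Qed.

Lemma sigma_tame_bigcup (C : set (nat -> H)) :
  countable C -> sigma_tame (\bigcup_(D in C) tame_closure D).
Proof.
move=> /countable_injP[g gI].
pose F n := [set x | exists D, [/\ C D, g D = n & tame_closure D x]].
have FE D : C D -> F (g D) = tame_closure D.
  move=> CD; apply/seteqP; split=> x; last by exists D.
  by move=> [D' [CD' gD Dx]]; rewrite -(gI D' D) ?inE.
have F0 n : ~ (exists D, C D /\ g D = n) -> F n = set0.
  move=> no; apply/seteqP; split=> // x [D [CD Dn _]].
  by apply: no; exists D.
exists F; split=> [n|n|x px [D CD Dx]]; last by exists (g D); rewrite FE.
- have [[D [CD <-]]|/F0 ->] := pselect (exists D, C D /\ g D = n).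
    by rewrite FE//; exact: tame_tame_closure.
  by move=> i; exists 0%N.
- have [[D [CD <-]]|/F0 ->] := pselect (exists D, C D /\ g D = n).
    by rewrite FE//; exact: closed_tame_closure.
  by move=> x px _; exists 0%N => y _ _ [].
Qed.

Lemma positive_not_sigma_tame : ~ sigma_tame (@positive R).
Proof.
pose one : H := fun=> clamp 1.
have p1 : positive one by move=> i; rewrite clampE ?ltr01// ler01 lexx.
move=> [F [tF cF hF]]; apply: (cylinder_not_sigma_tame 0 one p1).
by exists F; split=> // x px _; exact: hF.
Qed.

(** The sets that the construction has to meet in uncountably many points: the
    fibres and the domains of divergence of the partial real functions given by
    the values [h] on a sequence [D]. Those in the ideal are replaced by the
    whole space. *)
Definition target (q : (nat -> H) * (nat -> R) * R * bool) : set H :=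
  let: (D, h, c, b) := q in
  let T := if b then converges D h c else diverges D h in
  [set x | positive x /\ (sigma_tame T \/ T x)].

Lemma target_avoids q (C : set (nat -> H)) : countable C ->
  exists x, target q x /\ forall D, C D -> ~ tame_closure D x.
Proof.
move=> /sigma_tame_bigcup cC; apply: contrapT => no.
have {no cC} : sigma_tame (target q).
  apply: sigma_tame_sub cC => x qx; apply: contrapT => nx.
  by apply: no; exists x; split=> // D CD Dx; apply: nx; exists D.
case: q => [[[D h] c] b] /=; set T := if b then _ else _.
move=> [F [tF cF hF]].
have tT : sigma_tame T.
  by exists F; split=> // x px Tx; apply: hF => //; split=> //; right.
by apply: positive_not_sigma_tame; exists F; split=> // x px _;
  apply: hF => //; split=> //; left.
Qed.

End closures.

Theorem theorem4p6 (R : realType) :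
  continuum_hypothesis ->
  exists E : set (hilbert_cube R),
    [/\ has_card_continuum E,
        exists2 f : hilbert_cube R -> hilbert_cube R,
          {within E, continuous f} &
          forall A : set (hilbert_cube R), A `<=` E -> has_card_continuum A ->
            ~ unif_continuous_on A f
      & forall g : hilbert_cube R -> R, {within E, continuous g} ->
          exists A : set (hilbert_cube R),
            [/\ A `<=` E, has_card_continuum A &
                exists c : R, forall x, A x -> g x = c]].
Proof.
move=> CH.
have cH := @sub_continuum_cube R.
pose one : hilbert_cube R := fun=> clamp 1.
have [||k C|k x kx|E [EG cE uE]] := @luzin_set (hilbert_cube R) _ (nat -> hilbert_cube R)
  (@tame_closure R) (@target R) (fun=> one, fun=> 0, 0, true) (fun=> one) CH.
- apply: sub_continuum_prod; last exact: sub_continuum_bool.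
  apply: sub_continuum_prod; last exact: sub_continuum_real.
  apply: sub_continuum_prod; first exact: sub_continuum_seq.
  exact/sub_continuum_seq/sub_continuum_real.
- exact: sub_continuum_seq.
- exact: target_avoids.
- exists (fun=> x); apply: tame_closure_const.
  by case: k kx => [[[D h] c] b] [].
have Epos : E `<=` positive by move=> x /EG[[[[D h] c] b] []].
have E0 : E !=set0.
  apply/set0P/eqP => E0; apply: (uE (fun=> one, fun=> 0, 0, true)).
  by rewrite E0 set0I; exact: countable0.
exists E; split.
- apply: uncountable_continuum => // cEE.
  apply: (uE (fun=> one, fun=> 0, 0, true)).
  by apply: sub_countable cEE; apply: subset_card_le; exact: subIsetl.
- exists osc_map.
    apply: continuous_in_subspaceT => x /set_mem/Epos; exact: osc_map_continuous.
  move=> A AE /continuum_uncountable nA /unif_continuous_tame tA; apply: nA.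
  have [->|/set0P/dense_sequence[D [DA AD]]] := eqVneq A set0; first exact: countable0.
  apply: sub_countable (cE D); apply: subset_card_le => x Ax; split; first exact: AE.
  split; [exact/Epos/AE| |exact: AD].
  by apply: tame_sub tA => _ [k _ <-].
move=> g /subspace_continuousP cg.
have [D [DE ED]] := dense_sequence E E0.
pose h k := g (D k).
have conv x : E x -> converges D h (g x) x.
  move=> Ex; split; first exact: ED.
  move=> e e0; have := cg x Ex => /cvgrPdist_lt/(_ _ e0).
  move=> /cyl_nbhs[n hn]; exists n => k /hn/(_ (DE k)).
  by rewrite distrC.
have tdiv : sigma_tame (diverges D h).
  apply: contrapT => nt; apply: (uE (D, h, 0, false)).
  rewrite (_ : E `&` _ = set0); first exact: countable0.
  apply/seteqP; split=> // x [Ex [_ [//|dx]]].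
  by apply: dx; exists (g x); exact: conv.
have [c nc] := large_fibre D h tdiv.
exists (E `&` target (D, h, c, true)); split.
- exact: subIsetl.
- exact: uncountable_continuum.
- exists c => x [Ex [_ [//|xc]]].
  exact: converges_unique (conv x Ex) xc.
Qed.
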